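(* Fix a prime $p$. The classes $\mathcal U_p$ and $\mathcal M_p$ are one-dimensional asymptotic classes. The parameter-free interpretation of $\mathcal U_p$ in $\mathcal M_p$ by the $U$-sort is selector-trace reflecting, but $\mathcal U_p$ is not uniformly weakly bi-interpretable in $\mathcal M_p$.
   Context: For $n\ge1$, $U_n$ is a pure set (language of equality) of cardinality $p^n$; $V_n=\mathbb F_p^n$ in the vector-space language with addition, zero, and scalar multiplication by every element of $\mathbb F_p$; $M_n=(U_n,V_n)$ is the disjoint two-sorted union (no relations between the sorts). $\mathcal U_p=\{U_n:n\ge1\}$, $\mathcal M_p=\{M_n:n\ge1\}$. The interpretation of $\mathcal U_p$ in $\mathcal M_p$ sends $U_n$ to $M_n$, with domain the $U$-sort, equality as the equivalence relation, and the $U$-sort itself as selector. $|M|$ is the total number of elements (summed over sorts). Uniform little-$o$: for a collection $\Phi$ (a ''cell'') of pairs $(M,\bar a)$, $f=o(g)$ uniformly on $\Phi$ means: for every $\varepsilon>0$ there is $Q$ with $|f(M,\bar a)|\le\varepsilon g(M,\bar a)$ for all $(M,\bar a)\in\Phi$ with $|M|>Q$. One-dimensional asymptotic class: a class $\mathcal C$ of finite $L$-structures such that for every $L$-formula $\varphi(x;\bar y)$ with a single object variable $x$ there are a finite set $D_\varphi\subseteq(\{0,1\}\times\mathbb R_{>0})\cup\{(0,0)\}$ and, for each $(d,\mu)\in D_\varphi$, a parameter-free $L$-formula $\theta_{d,\mu}(\bar y)$ such that in every $M\in\mathcal C$ the $\theta_{d,\mu}$ partition the $\bar y$-tuples of $M$,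 and, uniformly on the cell $\{(M,\bar a):M\models\theta_{d,\mu}(\bar a)\}$, $|\varphi(M;\bar a)|=\mu|M|^{d}+o(|M|^{d})$; for $(0,0)$ this means $|\varphi(M;\bar a)|=o(1)$. Selector-trace reflecting (for this interpretation): for every $m\ge0$ and every parameter-free formula $\rho(u_1,\dots,u_m)$ in the language of $\mathcal M_p$ with all free variables in the $U$-sort, there is a parameter-free formula $\rho^{\downarrow}(y_1,\dots,y_m)$ in the language of equality such that for all $n\ge1$ and $\bar a\in U_n^m$: $U_n\models\rho^{\downarrow}(\bar a)\iff M_n\models\rho(\bar a)$. Interpretations are uniform parameter-free interpretations: an injection $\alpha$ from the interpreted class to the interpreting class, and fixed parameter-free formulas giving a domain in a fixed Cartesian power, an equivalence relation on it, and invariant relations, so that the quotient is isomorphic to the interpreted structure (many-sorted structures being treated via the standard one-sorted coding by sort predicates). Weak bi-interpretability. Suppose $A$ is parameter-free interpretable in $M$ by $\mathcal I$ and $M$ is parameter-free interpretable in $A$ by $\mathcal J$, with interpretation isomorphisms $f_A:A\to A^{\mathcal I}$ and $g_M:M\to M^{\mathcal J}$. Interpreting $g_M$ through $\mathcal I$ induces an isomorphism $g_M^{\mathcal I}:A^{\mathcal I}\to A^{\mathcal I\mathcal J}$. $A$ is weakly bi-interpretable in $M$ if $h_A=g_M^{\mathcal I}\circ f_A:A\to A^{\mathcal I\mathcal J}$ is parameter-free definable in $A$. A class $\mathcal D$ is uniformly weakly bi-interpretable in a class $\mathcal C$ if there are such interpretations, with each $A\in\mathcal D$ paired with $M=\alpha(A)\in\mathcal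 C$ for an injection $\alpha:\mathcal D\to\mathcal C$, for which the formulas of the forward interpretation $\mathcal I$, of the reverse interpretation $\mathcal J$, and the formula defining $h_A$ are all uniform (independent of $A$). *)

(* Defs.v *)
From mathcomp Require Import all_boot all_order all_algebra.
From mathcomp Require Import boolp reals.

Set Implicit Arguments.
Unset Strict Implicit.
Unset Printing Implicit Defensive.

Import Order.TTheory GRing.Theory Num.Theory.
Local Open Scope ring_scope.

(** * Many-sorted first-order logic over finite structures *)

(* [fsrt f i] is the sort of the [i]-th argument of [f], [fcod f] the sort of
   its value; similarly [rsrt] for relation symbols. *)
Record signature := Signature {
  sorts : finType;
  fsym : Type;
  far : fsym -> nat;
  fsrt : forall f, 'I_(far f) -> sorts;
  fcod : fsym -> sorts;
  rsym : Type;
  rar : rsym -> nat;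
  rsrt : forall r, 'I_(rar r) -> sorts }.

Arguments fsrt {s} f _.
Arguments rsrt {s} r _.

(* [term srt s] and [formula srt] only have free variables in [X], the variable
   [x : X] being of sort [srt x].  The quantifier [All s] binds the variable
   [None] of [option X].  There are no parameters.  The other connectives are
   definable, satisfaction being classical. *)
Inductive term (L : signature) (X : Type) (srt : X -> sorts L) :
    sorts L -> Type :=
| Var x : term srt (srt x)
| App f (ts : forall i, term srt (fsrt f i)) : term srt (fcod f).

Inductive formula (L : signature) (X : Type) (srt : X -> sorts L) : Type :=
| Eq s (t u : term srt s)
| Rel r (ts : forall i, term srt (rsrt r i))
| Bot
| Imp (phi psi : formula srt)
| All s (phi : formula (oapp srt s)).

Arguments Var {L X srt} x.
Arguments Bot {L X srt}.

Record fstruct (L : signature) := FStruct {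
  carrier :> sorts L -> finType;
  ifun : forall f : fsym L,
    (forall i, carrier (fsrt f i)) -> carrier (fcod f);
  irel : forall r : rsym L, (forall i, carrier (rsrt r i)) -> Prop }.

Arguments ifun {L} _ f _.
Arguments irel {L} _ r _.

Definition ssize (L : signature) (M : fstruct L) : nat :=
  (\sum_(s : sorts L) #|M s|)%N.

Definition env (L : signature) (M : fstruct L) (X : Type) (srt : X -> sorts L) :=
  forall x, M (srt x).

Definition env_ext (L : signature) (M : fstruct L) (X : Type)
    (srt : X -> sorts L) (s : sorts L) (a : M s) (e : env M srt) :
    env M (oapp srt s) :=
  fun o => match o return M (oapp srt s o) with Some x => e x | None => a end.

Fixpoint teval (L : signature) (M : fstruct L) (X : Type) (srt : X -> sorts L)
    (e : env M srt) (s : sorts L) (t : term srt s) : M s :=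
  match t with
  | Var x => e x
  | App f ts => ifun M f (fun i => teval e (ts i))
  end.

Fixpoint sat (L : signature) (M : fstruct L) (X : Type) (srt : X -> sorts L)
    (phi : formula srt) : env M srt -> Prop :=
  match phi with
  | Eq s t u => fun e => teval e t = teval e u
  | Rel r ts => fun e => irel M r (fun i => teval e (ts i))
  | Bot => fun _ => False
  | Imp phi1 phi2 => fun e => sat phi1 e -> sat phi2 e
  | All s phi1 => fun e => forall a : M s, sat phi1 (env_ext a e)
  end.

(** * One-dimensional asymptotic classes *)

(* Here [f], [g] are functions on pairs (structure, tuple), [sz] is the size of
   the structure, and [Phi] is the cell. *)
Definition unif_littleo (R : realType) (T : Type) (sz : T -> nat)
    (Phi : T -> Prop) (f g : T -> R) : Prop :=
  forall eps : R, 0 < eps ->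
    exists Q : nat, forall t, Phi t -> (Q < sz t)%N -> `|f t| <= eps * g t.

(* The number of [x] such that [phi(x; a)]; the object variable is [None]. *)
Definition nsol (L : signature) (M : fstruct L) (X : Type) (srt : X -> sorts L)
    (s : sorts L) (phi : formula (oapp srt s)) (a : env M srt) : nat :=
  #|[set x : M s | `[< sat phi (env_ext x a) >]]|.

(* A class of finite structures is given as an indexed family [C].  Note that
   for (d, mu) = (0, 0) the asymptotic clause reads |phi(M; a)| = o(1). *)
Definition one_dim_asymptotic_class (R : realType) (L : signature) (I : Type)
    (C : I -> fstruct L) : Prop :=
  forall (m : nat) (srt : 'I_m -> sorts L) (s : sorts L)
         (phi : formula (oapp srt s)),
  exists (D : seq (nat * R)) (theta : nat * R -> formula srt),
    [/\ forall c, c \in D ->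
          ((c.1 = 0%N \/ c.1 = 1%N) /\ 0 < c.2) \/ c = (0%N, 0),
        forall (i : I) (a : env (C i) srt),
          exists! c, c \in D /\ sat (theta c) a
      & forall c, c \in D ->
          unif_littleo
            (fun t : {i : I & env (C i) srt} => ssize (C (tag t)))
            (fun t => sat (theta c) (tagged t))
            (fun t => (nsol phi (tagged t))%:R
                      - c.2 * (ssize (C (tag t)))%:R ^+ c.1)
            (fun t => (ssize (C (tag t)))%:R ^+ c.1)].

(** * One-sorted relational languages and the one-sorted coding *)

Record rlang := RLang { rel1 : Type; ar1 : rel1 -> nat }.

Definition rsig (L : rlang) : signature :=
  @Signature unit
    void (fun=> 0%N) (fun _ _ => tt) (fun=> tt)
    (rel1 L) (@ar1 L) (fun _ _ => tt).

Notation rstruct L := (fstruct (rsig L)).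
Notation rformula L X := (@formula (rsig L) X (fun=> tt)).

Definition mk_rstruct (L : rlang) (T : finType)
    (r : forall r : rel1 L, ('I_(ar1 r) -> T) -> Prop) : rstruct L :=
  @FStruct (rsig L) (fun=> T) (fun f => match f with end) r.

Inductive code_rel (L : signature) :=
| SortPred of sorts L
| FunGraph of fsym L
| OldRel of rsym L.

Arguments SortPred {L} _.
Arguments FunGraph {L} _.
Arguments OldRel {L} _.

Definition code_ar (L : signature) (r : code_rel L) : nat :=
  match r with
  | SortPred _ => 1%N
  | FunGraph f => (far f).+1
  | OldRel r => rar r
  end.

Definition code_lang (L : signature) : rlang := RLang (@code_ar L).

Definition code_carrier (L : signature) (M : fstruct L) : finType :=
  {s : sorts L & M s}.

Definition code_elt (L : signature) (M : fstruct L) (s : sorts L) (x : M s) :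
    code_carrier M :=
  existT (fun s => M s) s x.

(* The universe is the disjoint union of the sorts.  The graph of a function
   symbol has the arguments first and the value last. *)
Definition code_irel (L : signature) (M : fstruct L) (r : code_rel L) :
    ('I_(code_ar r) -> code_carrier M) -> Prop :=
  match r return ('I_(code_ar r) -> code_carrier M) -> Prop with
  | SortPred s => fun v => tag (v ord0) = s
  | FunGraph f => fun v => exists args : forall i, M (fsrt f i),
      (forall i, v (lift ord_max i) = code_elt (args i)) /\
      v ord_max = code_elt (ifun M f args)
  | OldRel r => fun v => exists args : forall i, M (rsrt r i),
      (forall i, v i = code_elt (args i)) /\ irel M r args
  end.

Definition code_struct (L : signature) (M : fstruct L) : rstruct (code_lang L) :=
  @mk_rstruct (code_lang L) (code_carrier M) (@code_irel L M).

(** * Parameter-free interpretations *)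

(* Interpretation of [L1]-structures in [L2]-structures on [idim]-tuples.  In
   [ieqv] the variables [(false, j)] and [(true, j)] are the coordinates of the
   first and second tuple; in [irelf r], [(i, j)] is the [j]-th coordinate of
   the [i]-th tuple. *)
Record interp (L1 L2 : rlang) := Interp {
  idim : nat;
  idom : rformula L2 'I_idim;
  ieqv : rformula L2 (bool * 'I_idim);
  irelf : forall r : rel1 L1, rformula L2 ('I_(ar1 r) * 'I_idim) }.

Section Interpretation.
Variables (L1 L2 : rlang) (I : interp L1 L2) (M : rstruct L2).

Definition tup := {ffun 'I_(idim I) -> M tt}.

Definition tup_dom (t : tup) : Prop := sat (M := M) (idom I) t.

Definition tup_equiv (t u : tup) : Prop :=
  sat (M := M) (ieqv I) (fun x => if x.1 then u x.2 else t x.2).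

Definition tup_holds (r : rel1 L1) (v : 'I_(ar1 r) -> tup) : Prop :=
  sat (M := M) (irelf I r) (fun x => v x.1 x.2).

Definition well_defined : Prop :=
  [/\ forall t, tup_dom t -> tup_equiv t t,
      forall t u, tup_dom t -> tup_dom u -> tup_equiv t u -> tup_equiv u t,
      forall t u w, tup_dom t -> tup_dom u -> tup_dom w ->
        tup_equiv t u -> tup_equiv u w -> tup_equiv t w
    & forall (r : rel1 L1) (v w : 'I_(ar1 r) -> tup),
        (forall i, [/\ tup_dom (v i), tup_dom (w i) & tup_equiv (v i) (w i)]) ->
        (tup_holds v <-> tup_holds w)].

(* Elements of the quotient are the equivalence classes themselves, as sets of
   tuples. *)
Definition tup_classes : {set {set tup}} :=
  equivalence_partition (fun t u => `[< tup_equiv t u >]) [set t | `[< tup_dom t >]].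

Definition quot : finType := {C : {set tup} | C \in tup_classes}.

Definition quot_rel (r : rel1 L1) (v : 'I_(ar1 r) -> quot) : Prop :=
  exists2 w : 'I_(ar1 r) -> tup, (forall i, w i \in val (v i)) & tup_holds w.

Definition interp_struct : rstruct L1 := @mk_rstruct L1 quot quot_rel.

End Interpretation.

Definition isomorphism (L : rlang) (A B : rstruct L) (f : A tt -> B tt) : Prop :=
  bijective f /\
  forall (r : rel1 L) (v : 'I_(ar1 r) -> A tt),
    @irel (rsig L) A r v <-> @irel (rsig L) B r (fun i => f (v i)).

(* [I], with interpretation isomorphism [f], interprets [A] in [M]. *)
Definition interprets (L1 L2 : rlang) (I : interp L1 L2) (A : rstruct L1)
    (M : rstruct L2) (f : A tt -> interp_struct I M tt) : Prop :=
  well_defined I M /\ isomorphism f.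

(* A selector: a definable part of the domain meeting each class exactly once. *)
Definition selector (L1 L2 : rlang) (I : interp L1 L2) (M : rstruct L2)
    (sel : rformula L2 'I_(idim I)) : Prop :=
  (forall t : tup I M, sat (M := M) sel t -> tup_dom t) /\
  (forall C : quot I M, exists! t, t \in val C /\ sat (M := M) sel t).

(** * Uniform weak bi-interpretability *)

(* [gI] is the map induced by [g] on the structures interpreted by [I]. *)
Definition induced_map (L1 L2 : rlang) (I : interp L1 L2) (M N : rstruct L2)
    (g : M tt -> N tt)
    (gI : interp_struct I M tt -> interp_struct I N tt) : Prop :=
  forall C : quot I M,
    val (gI C : quot I N) = [set [ffun i => g (t i)] | t : tup I M in val C].

(* An element of [interp_struct I (interp_struct J A)] is a class of tuples of
   classes of tuples of [A]; [z] represents it when the classes of its rows form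
   a tuple belonging to it. *)
Definition represents (L1 L2 : rlang) (I : interp L1 L2) (J : interp L2 L1)
    (A : rstruct L1) (z : 'I_(idim I) * 'I_(idim J) -> A tt)
    (c : quot I (interp_struct J A)) : Prop :=
  exists2 t : tup I (interp_struct J A), t \in val c &
    forall i, [ffun j => z (i, j)] \in val (t i : quot J A).

(* [chi] defines in [A] the graph of [h]; the variable [None] stands for the
   argument of [h]. *)
Definition defines_map (L1 L2 : rlang) (I : interp L1 L2) (J : interp L2 L1)
    (A : rstruct L1) (chi : rformula L1 (option ('I_(idim I) * 'I_(idim J))))
    (h : A tt -> interp_struct I (interp_struct J A) tt) : Prop :=
  forall (a : A tt) (z : 'I_(idim I) * 'I_(idim J) -> A tt),
    sat (M := A) chi (oapp z a) <-> represents z (h a).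

Definition unif_weakly_biinterpretable (L1 L2 : rlang) (K1 K2 : Type)
    (D : K1 -> rstruct L1) (C : K2 -> rstruct L2) : Prop :=
  exists (alpha : K1 -> K2) (I : interp L1 L2) (J : interp L2 L1)
         (chi : rformula L1 (option ('I_(idim I) * 'I_(idim J)))),
    injective alpha /\
    forall k : K1,
      exists (f : D k tt -> interp_struct I (C (alpha k)) tt)
             (g : C (alpha k) tt -> interp_struct J (D k) tt)
             (gI : interp_struct I (C (alpha k)) tt ->
                   interp_struct I (interp_struct J (D k)) tt),
        [/\ interprets f, interprets g, induced_map g gI
          & defines_map chi (fun a => gI (f a))].

(** * The classes of pure sets and of pairs (pure set, vector space) *)

Definition posnat := {n : nat | (0 < n)%N}.

Definition set_lang : rlang := @RLang void (fun=> 0%N).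

Definition Uset (p : nat) (n : posnat) : rstruct set_lang :=
  @mk_rstruct set_lang 'I_(p ^ val n) (fun r => match r with end).

Definition Usort : bool := true.
Definition Vsort : bool := false.

Inductive vfun (p : nat) := VZero | VAdd | VScal of 'F_p.

Definition vfun_ar (p : nat) (f : vfun p) : nat :=
  match f with VZero => 0%N | VAdd => 2%N | VScal _ => 1%N end.

Definition UV_sig (p : nat) : signature :=
  @Signature bool
    (vfun p) (@vfun_ar p) (fun _ _ => Vsort) (fun=> Vsort)
    void (fun=> 0%N) (fun r => match r with end).

Definition UV_carrier (p n : nat) (s : bool) : finType :=
  if s then 'I_(p ^ n) : finType else 'rV['F_p]_n : finType.

Definition UV_fun (p n : nat) (f : vfun p) :
    ('I_(vfun_ar f) -> 'rV['F_p]_n) -> 'rV['F_p]_n :=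
  match f with
  | VZero => fun=> 0
  | VAdd => fun v => v ord0 + v ord_max
  | VScal c => fun v => c *: v ord0
  end.

Definition UVpair (p : nat) (n : posnat) : fstruct (UV_sig p) :=
  @FStruct (UV_sig p) (UV_carrier p (val n)) (@UV_fun p (val n))
    (fun r => match r with end).

Definition UVcode (p : nat) (n : posnat) : rstruct (code_lang (UV_sig p)) :=
  code_struct (UVpair p n).

(** * The interpretation by the [U]-sort *)

Definition Uformula (p : nat) : rformula (code_lang (UV_sig p)) 'I_1 :=
  @Rel (rsig (code_lang (UV_sig p))) 'I_1 (fun=> tt)
    (@SortPred (UV_sig p) Usort) (fun=> Var ord0).

Definition Uinterp (p : nat) : interp set_lang (code_lang (UV_sig p)) :=
  @Interp set_lang (code_lang (UV_sig p)) 1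
    (Uformula p)
    (@Eq (rsig (code_lang (UV_sig p))) (bool * 'I_1) (fun=> tt) tt
       (Var (false, ord0)) (Var (true, ord0)))
    (fun r => match r with end).

(* The element [u] of [Uset p n] as an element of the coded structure. *)
Definition Uelt (p : nat) (n : posnat) (u : 'I_(p ^ val n)) : UVcode p n tt :=
  @code_elt (UV_sig p) (UVpair p n) Usort u.

(* [U_n] is interpreted in [M_n] by the tautological map sending [u] to the
   class {u}, and the [U]-sort is a selector. *)
Definition Uinterp_correct (p : nat) : Prop :=
  forall n : posnat,
    (exists f : Uset p n tt -> interp_struct (Uinterp p) (UVcode p n) tt,
       interprets f /\
       forall u : 'I_(p ^ val n),
         val (f u : quot (Uinterp p) (UVcode p n)) = [set [ffun=> Uelt u]])
    /\ selector (I := Uinterp p) (UVcode p n) (Uformula p).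

(* As the [U]-sort of [UVpair p n] is literally the universe of [Uset p n], a
   tuple [a] serves as an assignment in both structures. *)
Definition selector_trace_reflecting (p : nat) : Prop :=
  forall (m : nat) (rho : @formula (UV_sig p) 'I_m (fun=> Usort)),
  exists rho' : rformula set_lang 'I_m,
    forall (n : posnat) (a : 'I_m -> 'I_(p ^ val n)),
      sat (M := Uset p n) rho' a <-> sat (M := UVpair p n) rho a.

(* Main.v *)
Require Import Defs.
From mathcomp Require Import all_boot all_order all_algebra all_fingroup.
From mathcomp Require Import boolp reals.

(* One-dimensionality: elements outside the hull of the parameters (the listed
   elements of [U], the span in [V]) are conjugate over them, so a definable
   subset of a sort is either inside the hull or contains its complement.
   Both cases are told apart by counting quantifiers, without quantifier
   elimination.

   Trace reflection: by the Tarski-Vaught argument over such hulls, embeddings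
   [M_n -> M_n'] preserve a given formula once [n] is large, so its trace on [U]
   depends only on the equality pattern of the tuple and on [min(n, n0)], which
   the pure set can express.

   Failure of bi-interpretability: already [M_n] is not uniformly interpretable
   in pure sets.  [Sym(U)] acts by group automorphisms on the interpreted [V],
   and every vector has a support of size at most the dimension [d] of the
   interpretation.  Adding to a vector a conjugate of it with disjoint support
   would produce larger minimal supports, so the action is trivial, and then
   [V] injects into the set of equality patterns of [d]-tuples. *)

Set Implicit Arguments.
Unset Strict Implicit.
Unset Printing Implicit Defensive.

Import Order.TTheory GRing.Theory Num.Theory.
Local Open Scope ring_scope.

(** * Satisfaction, substitution and counting quantifiers *)

Section Isomorphisms.
Variables (L : signature) (M N : fstruct L) (h : forall s, M s -> N s).

Definition preserves_functions : Prop :=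
  forall (f : Defs.fsym L) (args : forall i, M (fsrt f i)),
  h (ifun M f args) = ifun N f (fun i => h (args i)).

Definition struct_iso : Prop :=
  [/\ forall s, bijective (@h s), preserves_functions
    & forall (r : rsym L) (args : forall i, M (rsrt r i)),
        irel M r args <-> irel N r (fun i => h (args i))].

Lemma teval_hom (hfun : preserves_functions) (X : Type) (srt : X -> sorts L)
    (e : env M srt) s (t : term srt s) :
  teval (fun x => h (e x)) t = h (teval e t).
Proof.
elim: t => [//|f ts IH] /=; rewrite hfun; congr (ifun N f _).
by apply: functional_extensionality_dep => i; rewrite IH.
Qed.

Lemma env_ext_hom (X : Type) (srt : X -> sorts L) (e : env M srt) s (a : M s) :
  (fun x => h (env_ext a e x)) = env_ext (h a) (fun x => h (e x)).
Proof. by apply: functional_extensionality_dep => -[]. Qed.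

Lemma sat_iso (hiso : struct_iso) (X : Type) (srt : X -> sorts L)
    (phi : formula srt) (e : env M srt) :
  sat phi e <-> sat (M := N) phi (fun x => h (e x)).
Proof.
have [hbij hfun hrel] := hiso.
elim: phi e => {X srt} [X srt s t u|X srt r ts|X srt|X srt phi IH1 psi IH2|
  X srt s phi IH] e //=.
- by rewrite !teval_hom //; split=> [->//|/(bij_inj (hbij s))].
- rewrite hrel; set v := (fun i => _); set w := (fun i => _).
  suff -> : v = w by [].
  by apply: functional_extensionality_dep => i; rewrite /v /w teval_hom.
- by rewrite IH1 IH2.
split=> [H b|H a].
  have [g _ gK] := hbij s.
  by rewrite -(gK b) -env_ext_hom; apply/IH/H.
by apply/IH; rewrite env_ext_hom; apply: H.
Qed.

End Isomorphisms.

Section Connectives.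
Variables (L : signature) (X : Type) (srt : X -> sorts L).

Definition fTrue : formula srt := Imp Bot Bot.
Definition fNot (phi : formula srt) : formula srt := Imp phi Bot.
Definition fAnd (phi psi : formula srt) : formula srt :=
  fNot (Imp phi (fNot psi)).
Definition fOr (phi psi : formula srt) : formula srt := Imp (fNot phi) psi.
Definition fEx s (phi : formula (oapp srt s)) : formula srt :=
  fNot (All (Imp phi Bot)).
Definition fBigAnd (T : Type) (s : seq T) (F : T ->
  formula srt) : formula srt :=
  foldr (fun t phi => fAnd (F t) phi) fTrue s.
Definition fBigOr (T : Type) (s : seq T) (F : T -> formula srt) : formula srt :=
  foldr (fun t phi => fOr (F t) phi) Bot s.

Variables (M : fstruct L) (e : env M srt).

Lemma sat_fNot phi : sat (fNot phi) e <-> ~ sat phi e.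
Proof. by []. Qed.

Lemma sat_fAnd phi psi : sat (fAnd phi psi) e <-> sat phi e /\ sat psi e.
Proof.
split=> [/= H|/= [H1 H2] /(_ H1 H2)//].
by split; apply: contrapT => N; apply: H => H1 H2; apply: N.
Qed.

Lemma sat_fOr phi psi : sat (fOr phi psi) e <-> sat phi e \/ sat psi e.
Proof.
split=> [/= H|/= [H1 /(_ H1)//|//]].
by have [?|?] := pselect (sat phi e); [left|right; apply: H].
Qed.

Lemma sat_fEx s (phi : formula (oapp srt s)) :
  sat (fEx phi) e <-> exists a, sat phi (env_ext a e).
Proof.
split=> [/= H|/= [a H] /(_ a)//].
by apply: contrapT => N; apply: H => a Ha; apply: N; exists a.
Qed.

Lemma sat_fBigAnd (T : eqType) (s : seq T) F :
  sat (fBigAnd s F) e <-> forall t, t \in s -> sat (F t) e.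
Proof.
elim: s => [|t s IH]; first by split=> [_ t|_ []]; rewrite ?in_nil.
split=> [/sat_fAnd[Ht /IH Hs] u|H].
  by rewrite inE => /predU1P[->|/Hs].
apply/sat_fAnd; split; first by apply: H; rewrite mem_head.
by apply/IH => u us; apply: H; rewrite inE us orbT.
Qed.

Lemma sat_fBigOr (T : eqType) (s : seq T) F :
  sat (fBigOr s F) e <-> exists2 t, t \in s & sat (F t) e.
Proof.
elim: s => [|t s IH]; first by split => // -[].
split=> [/sat_fOr[Ht|/IH[u us Hu]]|[u]].
- by exists t; rewrite ?mem_head.
- by exists u; first by rewrite inE us orbT.
rewrite inE => /predU1P[->|us] Hu; apply/sat_fOr; first by left.
by right; apply/IH; exists u.
Qed.

End Connectives.

Section Substitution.
Variable L : signature.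

Fixpoint tsubst (X Y : Type) (srtX : X -> sorts L) (srtY : Y -> sorts L)
    (sg : forall x, term srtY (srtX x)) s (t : term srtX s) : term srtY s :=
  match t with
  | Var x => sg x
  | App f ts => App (fun i => tsubst sg (ts i))
  end.

Definition lift_subst (X Y : Type) (srtX : X -> sorts L) (srtY : Y -> sorts L)
    (sg : forall x, term srtY (srtX x)) (s : sorts L) (o : option X) :
    term (oapp srtY s) (oapp srtX s o) :=
  match o return term (oapp srtY s) (oapp srtX s o) with
  | Some x => tsubst (fun y => @Var _ _ (oapp srtY s) (Some y)) (sg x)
  | None => @Var _ _ (oapp srtY s) None
  end.

Fixpoint fsubst (X Y : Type) (srtX : X -> sorts L) (srtY : Y -> sorts L)
    (sg : forall x, term srtY (srtX x)) (phi : formula srtX) : formula srtY :=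
  match phi with
  | Eq s t u => Eq (tsubst sg t) (tsubst sg u)
  | Rel r ts => Rel (fun i => tsubst sg (ts i))
  | Bot => Bot
  | Imp phi psi => Imp (fsubst sg phi) (fsubst sg psi)
  | All s phi => All (fsubst (lift_subst sg s) phi)
  end.

Lemma teval_subst (M : fstruct L) (X Y : Type) (srtX : X -> sorts L)
    (srtY : Y -> sorts L) (sg : forall x, term srtY (srtX x)) s
    (t : term srtX s) (e : env M srtY) :
  teval e (tsubst sg t) = teval (fun x => teval e (sg x)) t.
Proof.
elim: t => [//|f ts IH] /=; congr (ifun M f _).
by apply: functional_extensionality_dep.
Qed.

Lemma sat_subst (M : fstruct L) (X Y : Type) (srtX : X -> sorts L)
    (srtY : Y -> sorts L) (sg : forall x, term srtY (srtX x))
    (phi : formula srtX) (e : env M srtY) :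
  sat (fsubst sg phi) e <-> sat phi (fun x => teval e (sg x)).
Proof.
elim: phi Y srtY sg e => {X srtX} [X srt s t u|X srt r ts|X srt|
  X srt phi IH1 psi IH2|X srt s phi IH] Y srtY sg e //=.
- by rewrite !teval_subst.
- set v := (fun i => _); set w := (fun i => _).
  suff -> : v = w by [].
  by apply: functional_extensionality_dep => i; rewrite /v /w teval_subst.
- by rewrite IH1 IH2.
have E a : (fun x => teval (env_ext a e) (@lift_subst _ _ _ _ sg s x)) =
  env_ext a (fun x => teval e (sg x)).
  by apply: functional_extensionality_dep => -[x|] //=; rewrite teval_subst.
by split=> H a; have := H a; rewrite IH E.
Qed.
End Substitution.

Section Counting.
Variable L : signature.

(** [Some None] is the witness chosen earlier and [None] the fresh one: the renaming sends the
    object variable to the fresh one and skips the witness. *)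
Definition weaken_under (X : Type) (srt : X -> sorts L) s (o : option X) :
    term (oapp (oapp srt s) s) (oapp srt s o) :=
  match o return term (oapp (oapp srt s) s) (oapp srt s o) with
  | Some x => @Var _ _ (oapp (oapp srt s) s) (Some (Some x))
  | None => @Var _ _ (oapp (oapp srt s) s) None
  end.

(** After one witness is chosen, [k'] further solutions different from it are required. That
    condition lives in a context with one more variable, so the recursion varies [X] and [srt]. *)
Fixpoint atleast (k : nat) (X : Type) (srt : X -> sorts L) s
    (phi : formula (oapp srt s)) : formula srt :=
  if k is k'.+1 then
    fEx (fAnd phi (atleast k' (s := s)
      (fAnd (fsubst (@weaken_under _ srt s) phi)
         (fNot (@Eq _ _ (oapp (oapp srt s) s) s
                  (@Var _ _ (oapp (oapp srt s) s) None)
                  (@Var _ _ (oapp (oapp srt s) s) (Some None)))))))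
  else fTrue srt.

Lemma sat_atleast (M : fstruct L) k (X : Type) (srt : X -> sorts L) s
    (phi : formula (oapp srt s)) (e : env M srt) :
  sat (atleast k phi) e <-> (k <= nsol phi e)%N.
Proof.
elim: k X srt phi e => [|k IH] X srt phi e; first by split=> // _ [].
(* Removing [a] from the solution set leaves exactly the solution set of the formula in the
   recursive call. *)
have step a : sat phi (env_ext a e) -> nsol phi e =
    (nsol (fAnd (fsubst (@weaken_under _ srt s) phi)
         (fNot (@Eq _ _ (oapp (oapp srt s) s) s
                  (@Var _ _ (oapp (oapp srt s) s) None)
                  (@Var _ _ (oapp (oapp srt s) s) (Some None)))))
      (env_ext a e)).+1.
  move=> Ha; rewrite /nsol (cardsD1 a) inE asboolT // add1n; congr _.+1.
  congr #|pred_of_set _|; apply/setP=> b; rewrite !inE.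
  apply/andP/asboolP => [[/eqP ba /asboolP Hb]|/sat_fAnd[Hb ba]].
    apply/sat_fAnd; split=> //.
    rewrite sat_subst; move: Hb; congr (sat phi _).
    by apply: functional_extensionality_dep => -[].
  split; first by apply/eqP.
  apply/asboolP; move: Hb; rewrite sat_subst; congr (sat phi _).
  by apply: functional_extensionality_dep => -[].
split=> [/sat_fEx[a /sat_fAnd[Ha /IH H]]|H].
  by rewrite (step a).
have /card_gt0P[a] : (0 < nsol phi e)%N by apply: leq_trans H.
rewrite inE => /asboolP Ha.
by apply/sat_fEx; exists a; apply/sat_fAnd; split=> //; apply/IH;
  rewrite -ltnS -step.
Qed.

End Counting.

(** * Asymptotic classes from a counting dichotomy *)

Section Dichotomy.
Variables (R : realType) (L : signature) (I : Type) (C : I -> fstruct L).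

(* The cells are "exactly [c] solutions", for [c <= B], and "more than [B]
   solutions". *)
Lemma one_dim_of_dichotomy (mu : R) (mu0 : 0 < mu)
    (size_sort : forall i s, #|C i s|%:R = mu * (ssize (C i))%:R)
    (dichotomy : forall (m : nat) (srt : 'I_m -> sorts L) s
      (phi : formula (oapp srt s)), exists B, forall i (a : env (C i) srt),
      (nsol phi a <= B)%N \/ (#|C i s| <= nsol phi a + B)%N) :
  one_dim_asymptotic_class R C.
Proof.
move=> m srt s phi; have [B HB] := dichotomy m srt s phi.
(* The second entry of a finite cell is the number of solutions, as a real; [Num.truncn] recovers
   it. *)
pose theta (c : nat * R) : formula srt :=
  if c.1 == 1%N then atleast B.+1 phi
  else fAnd (atleast (Num.truncn c.2) phi)
            (fNot (atleast (Num.truncn c.2).+1 phi)).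
have theta1 i (a : env (C i) srt) : sat (theta (1%N, mu)) a <->
  (B < nsol phi a)%N.
  exact: sat_atleast.
have theta0 i (a : env (C i) srt) k :
    sat (theta (0%N, k%:R)) a <-> nsol phi a = k.
  have -> : theta (0%N, k%:R) = fAnd (atleast k phi) (fNot (atleast k.+1 phi)).
    by rewrite /theta natrK.
  rewrite sat_fAnd sat_fNot !sat_atleast.
  split=> [[le_k /negP]|->]; last by rewrite ltnn.
  by rewrite -leqNgt => ge_k; apply/eqP; rewrite eqn_leq ge_k.
exists ((1%N, mu) :: [seq (0%N, k%:R) | k <- iota 0 B.+1]), theta.
have inD k : (k <= B)%N ->
    (0%N, k%:R) \in (1%N, mu) :: [seq (0%N, k%:R : R) | k <- iota 0 B.+1].
  by move=> le_k; rewrite inE; apply/orP; right; apply/map_f; rewrite mem_iota.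
split=> [c|i a|c].
- rewrite inE => /predU1P[->|/mapP[k _ ->]]; first by left; split; [right|].
  by case: k => [|k]; [right|left; split; [left|rewrite ltr0n]].
- have [lt_B|le_B] := ltnP B (nsol phi a).
    exists (1%N, mu); split=> [|c []]; first by rewrite mem_head; split=> //;
      apply/theta1.
    rewrite inE => /predU1P[->//|/mapP[k]];
      rewrite mem_iota => /andP[_ le_k] -> /theta0 E.
    by move: lt_B; rewrite E ltnNge -ltnS le_k.
  exists (0%N, (nsol phi a)%:R); split=> [|c []]; first by split;
    [exact: inD|apply/theta0].
  rewrite inE => /predU1P[-> /theta1|/mapP[k _ -> /theta0->//]].
  by rewrite ltnNge le_B.
rewrite inE => /predU1P[->|/mapP[k _ ->]] eps eps0; last first.
  (* On a finite cell the count is exact, so the error is zero for every size. *)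
  exists 0%N => -[i a] /= /theta0 -> _; rewrite expr0 mulr1 subrr normr0.
  by rewrite mulr1 ltW.
(* Beyond this [Q] the size exceeds [B / eps], so the at most [B] elements of the sort that are not
   solutions amount to at most [eps] times the size. *)
exists (Num.bound (B%:R / eps)) => -[i a] /= /theta1 lt_B lt_Q.
have le_C : (#|C i s| <= nsol phi a + B)%N
  by case: (HB i a) => // le; rewrite ltnNge le in lt_B.
rewrite expr1 -(size_sort i s).
have le_nsol : (nsol phi a <= #|C i s|)%N by apply: max_card.
rewrite distrC ger0_norm ?subr_ge0 ?ler_nat //.
rewrite lerBlDl (le_trans (y := (nsol phi a + B)%:R)) ?ler_nat // natrD lerD2l.
rewrite -ler_pdivrMl // mulrC ltW // (lt_trans (archi_boundP _)) ?ltr_nat //.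
by rewrite divr_ge0 // ltW.
Qed.

End Dichotomy.

(** * One-dimensionality of [U_p] and [M_p] *)

Section Dichotomies.
Variables (L : signature) (M : fstruct L).

Lemma sat_conj (h : forall s, M s -> M s) (hiso : struct_iso h)
    (X : Type) (srt : X -> sorts L) (e : env M srt) s (x y : M s)
    (phi : formula (oapp srt s)) :
  (forall z, h _ (e z) = e z) -> h _ x = y ->
  sat phi (env_ext x e) <-> sat phi (env_ext y e).
Proof.
move=> he hx; rewrite (sat_iso hiso) env_ext_hom hx.
by have -> : (fun z => h _ (e z)) = e by apply: functional_extensionality_dep.
Qed.

(** One solution outside [K] makes every element outside [K] a solution; if there is none, all
    solutions lie in [K]. *)
Lemma nsol_dichotomy (X : Type) (srt : X -> sorts L) (e : env M srt) s
    (phi : formula (oapp srt s)) (K : {set M s}) :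
  (forall x y, x \notin K -> y \notin K ->
     sat phi (env_ext x e) -> sat phi (env_ext y e)) ->
  (nsol phi e <= #|K|)%N \/ (#|M s| <= nsol phi e + #|K|)%N.
Proof.
move=> conj; rewrite /nsol; set S := [set x | _].
have [SK|/subsetPn[x]] := boolP (S \subset K); first by left;
  apply: subset_leq_card.
rewrite inE => /asboolP Hx xK; right.
rewrite -(cardsC K) addnC leq_add2r subset_leq_card //.
apply/subsetP => y; rewrite !inE => yK; apply/asboolP; exact: conj Hx.
Qed.

End Dichotomies.

Lemma ssize_Uset p n : ssize (Uset p n) = (p ^ val n)%N.
Proof. by rewrite /ssize (big_pred1 tt) ?card_ord // => -[]. Qed.

(** Two elements outside the parameter set are exchanged by a transposition fixing all parameters,
    of which there are at most [m]. *)
Lemma Uset_one_dim (R : realType) p : one_dim_asymptotic_class R (Uset p).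
Proof.
apply: (@one_dim_of_dichotomy _ _ _ _ 1) => // [n s|m srt s phi].
  by rewrite ssize_Uset mul1r card_ord.
exists m => n a.
pose K : {set Uset p n s} := [set a i | i : 'I_m].
have cK : (#|K| <= m)%N by rewrite -[leqRHS]card_ord leq_imset_card.
suff : (nsol phi a <= #|K|)%N \/ (#|Uset p n s| <= nsol phi a + #|K|)%N.
  case=> H; [left; exact: leq_trans H cK|right; apply: (leq_trans H)].
  by rewrite leq_add2l.
apply: nsol_dichotomy => x y xK yK.
suff h_iso : struct_iso (M := Uset p n) (N :=
  Uset p n) (fun _ : unit => tperm x y).
  have aK z : tperm x y (a z) = a z.
    have azK : a z \in K by apply: imset_f.
    by rewrite tpermD //; apply: contraTneq azK => <-.
  by case: (sat_conj h_iso phi aK (tpermL x y)).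
by split=> [?|[]|[]]; exact: (Bijective (tpermK x y) (tpermK x y)).
Qed.

(** * Automorphisms of [M_n] over a finitely generated hull *)

Section SetAndSpace.
Variables (p : nat) (hp : prime p).

(** Vectors are rows and [B] multiplies from the right; a rectangular [B] lets one definition serve
    for automorphisms and for embeddings into a larger [M_n']. *)
Definition UVmap (n n' : posnat) (fU : 'I_(p ^ val n) -> 'I_(p ^ val n'))
    (B : 'M['F_p]_(val n, val n')) (s : bool) : UVpair p n s -> UVpair p n' s :=
  match s return UVpair p n s -> UVpair p n' s with
  | true => fU
  | false => fun v : 'rV_(val n) => v *m B
  end.

Lemma UVmap_preserves (n n' : posnat) (fU : 'I_(p ^ val n) -> 'I_(p ^ val n'))
    (B : 'M['F_p]_(val n, val n')) : 
  preserves_functions (M := UVpair p n) (N := UVpair p n') (UVmap fU B).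
Proof.
case=> [||c] args; first exact: mul0mx; first exact: mulmxDl.
exact/esym/scalemxAl.
Qed.

Lemma UVmap_inj (n n' : posnat) (fU : 'I_(p ^ val n) -> 'I_(p ^ val n'))
    (B : 'M['F_p]_(val n, val n')) :
  injective fU -> (forall v : 'rV_(val n), v *m B = 0 -> v = 0) ->
  forall s, injective (UVmap fU B (s := s)).
Proof.
move=> fU_inj B_inj [] //= u v E.
by apply/eqP; rewrite -subr_eq0; apply/eqP/B_inj; rewrite mulmxBl E subrr.
Qed.

Lemma UVmap_iso (n : posnat) (fU : 'I_(p ^ val n) -> 'I_(p ^ val n))
    (B : 'M['F_p]_(val n)) :
  injective fU -> (forall v : 'rV_(val n), v *m B = 0 -> v = 0) ->
  struct_iso (M := UVpair p n) (N := UVpair p n) (UVmap fU B).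
Proof.
move=> fU_inj B_inj; split; [|exact: UVmap_preserves|by case].
by move=> s; apply/injF_bij/UVmap_inj.
Qed.

(** The substructure generated by [A] and the rows of [W]. Allowing [k] possibly dependent rows
    bounds the dimension without computing ranks. *)
Definition hull n k (A : {set 'I_(p ^ n)}) (W : 'M['F_p]_(k, n)) (s : bool) :
    UV_carrier p n s -> bool :=
  match s return UV_carrier p n s -> bool with
  | true => fun u => u \in A
  | false => fun v : 'rV_n => (v <= W)%MS
  end.

(** The same bound serves both sorts because [k < p ^ k]. *)
Lemma card_hull n k (A : {set 'I_(p ^ n)}) (W : 'M['F_p]_(k, n)) s :
  (#|A| <= k)%N -> (#|[set x | hull A W (s := s) x]| <= p ^ k)%N.
Proof.
move=> Ak; case: s => /=.
  by rewrite cardsE (leq_trans Ak) // ltnW // ltn_expl // prime_gt1.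
suff -> : [set v | (v <= W)%MS] = [set c *m W | c : 'rV_k].
  by rewrite (leq_trans (leq_imset_card _ _)) // card_mx card_Fp // mul1n.
apply/setP => v; rewrite inE; apply/submxP/imsetP => -[c].
  by exists c.
by move=> _ ->; exists c.
Qed.

(** Some column of the cokernel matrix of [W] does not vanish at [x]. *)
Lemma separating_form n k (W : 'M['F_p]_(k, n)) (x : 'rV_n) : ~~ (x <= W)%MS ->
  exists2 f : 'cV_n, W *m f = 0 & (x *m f) 0 0 != 0.
Proof.
rewrite submxE => /matrix0Pn[i [j]]; rewrite (ord1 i) => nz.
exists (cokermx W *m delta_mx j 0); first by rewrite mulmxA mulmx_coker mul0mx.
by rewrite mulmxA -colE mxE.
Qed.

(** Take forms [f], [g] vanishing on [W] with [f(x)] and [g(y)] nonzero. If [f(y) = 0] and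
    [g(x) = 0], their sum is nonzero at both; scaling makes the value at [x] equal to 1. *)
Lemma common_form n k (W : 'M['F_p]_(k, n)) (x y : 'rV_n) :
  ~~ (x <= W)%MS -> ~~ (y <= W)%MS ->
  exists f : 'cV_n, [/\ W *m f = 0, (x *m f) 0 0 = 1 & (y *m f) 0 0 != 0].
Proof.
move=> xW yW.
suff [f [fW fx fy]] : exists f : 'cV_n,
    [/\ W *m f = 0, (x *m f) 0 0 != 0 & (y *m f) 0 0 != 0].
  exists (((x *m f) 0 0)^-1 *: f); split.
  - by rewrite -scalemxAr fW scaler0.
  - by rewrite -scalemxAr mxE mulVf.
  - by rewrite -scalemxAr mxE mulf_neq0 ?invr_eq0.
have [f fW fx] := separating_form xW; have [g gW gy] := separating_form yW.
have [fy|fy] := eqVneq ((y *m f) 0 0) 0; last by exists f.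
have [gx|gx] := eqVneq ((x *m g) 0 0) 0; last by exists g.
exists (f + g); rewrite !mulmxDr fW gW addr0; split=> //.
  by rewrite mxE gx addr0.
by rewrite mxE fy add0r.
Qed.

(** On [U] a transposition does it. On [V] take [v + f(v) (y - x)] with [f] from [common_form]: it
    fixes the kernel of [f], which contains [W], and sends [x] to [y] since [f(x) = 1]. *)
Lemma hull_transitive (n : posnat) k (A : {set 'I_(p ^ val n)})
    (W : 'M['F_p]_(k, val n)) (s : bool) (x y : UVpair p n s) :
  ~~ hull A W x -> ~~ hull A W y ->
  exists h : forall s, UVpair p n s -> UVpair p n s,
    [/\ struct_iso (M := UVpair p n) (N := UVpair p n) h,
        forall s (z : UVpair p n s), hull A W z -> h s z = z
      & h s x = y].
Proof.
case: s x y => /= x y xA yA.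
  exists (UVmap (tperm x y) 1%:M); split=> [|[] z /=|].
  - by apply: UVmap_iso => [|v]; [exact: perm_inj|rewrite mulmx1].
  - by move=> zA; rewrite tpermD //; apply: contraTneq zA => <-.
  - by rewrite mulmx1.
  - exact: tpermL.
have [f [fW fx fy]] := common_form xA yA.
have actE (v w : 'rV_(val n)) : v *m (f *m w) = (v *m f) 0 0 *: w.
  by rewrite mulmxA {1}[v *m f]mx11_scalar mul_scalar_mx.
exists (UVmap id (1%:M + f *m (y - x))); split=> [|[] z //=|/=].
- apply: UVmap_iso => // v; rewrite mulmxDr mulmx1 actE => E.
  suff fv : (v *m f) 0 0 = 0 by rewrite fv scale0r addr0 in E.
  (* Applying [f] to the equation gives [f(v) f(y) = 0], where [f(y)] is nonzero. *)
  have := congr1 (fun u : 'rV_(val n) => (u *m f) 0 0) E.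
  rewrite /= mul0mx mulmxDl -scalemxAl mulmxBl.
  move: fx fy; set a := x *m f; set b := y *m f; set c := v *m f.
  rewrite !mxE => -> fy; rewrite -[X in X + _]mulr1 -mulrDr addrCA subrr addr0
    => /eqP.
  by rewrite mulf_eq0 (negPf fy) orbF => /eqP.
- case/submxP => c ->; rewrite mulmxDr mulmx1 actE -mulmxA fW mulmx0.
  by rewrite mxE scale0r addr0.
- by rewrite mulmxDr mulmx1 actE fx scale1r addrCA subrr addr0.
Qed.

Lemma card_UV n s : #|UVpair p n s| = (p ^ val n)%N.
Proof. by case: s; rewrite /= ?card_ord // card_mx card_Fp // mul1n. Qed.

Lemma ssize_UV n : ssize (UVpair p n) = (2 * p ^ val n)%N.
Proof. by rewrite /ssize big_bool !card_UV /= addnn mul2n. Qed.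

Lemma hull_env n m (srt : 'I_m -> bool) (a : env (UVpair p n) srt) :
  exists (A : {set 'I_(p ^ val n)}) (W : 'M['F_p]_(m, val n)),
    (#|A| <= m)%N /\ forall x, hull A W (a x).
Proof.
(* A parameter of the other sort becomes [None] or the zero row, which add nothing to the hull. *)
pose toU s : UVpair p n s -> option 'I_(p ^ val n) :=
  match s return UVpair p n s -> option 'I_(p ^ val n) with
  | true => fun u => Some u | false => fun=> None end.
pose toV s : UVpair p n s -> 'rV['F_p]_(val n) :=
  match s return UVpair p n s -> 'rV['F_p]_(val n) with
  | true => fun=> 0 | false => fun v => v end.
exists [set u | Some u \in [set toU _ (a i) | i :
  'I_m]], (\matrix_i toV _ (a i)).
split.
  rewrite -(card_imset _ (@Some_inj _)) -[leqRHS]card_ord.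
  apply: leq_trans (leq_imset_card (fun i => toU _ (a i)) _);
    apply/subset_leq_card.
  by apply/subsetP => _ /imsetP[u + ->]; rewrite inE.
move=> x; have: toU _ (a x) \in [set toU _ (a i) | i : 'I_m] by apply: imset_f.
have: (toV _ (a x) <= \matrix_i toV _ (a i))%MS.
  by rewrite -[X in (X <= _)%MS](rowK (fun i => toV _ (a i)) x) row_sub.
by move: (a x); rewrite /hull; case: (srt x) => /= z // _; rewrite inE.
Qed.

(** Both sorts have [p ^ n] elements, so each is half of the structure. The hull of [m] parameters
    has at most [p ^ m] elements in each sort, a bound independent of [n]. *)
Lemma UVpair_one_dim (R : realType) : one_dim_asymptotic_class R (UVpair p).
Proof.
apply: (@one_dim_of_dichotomy _ _ _ _ 2^-1) => [|n s|m srt s phi].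
- by rewrite invr_gt0 ltr0n.
- by rewrite ssize_UV card_UV natrM mulKf // pnatr_eq0.
exists (p ^ m)%N => n a; have [A [W [Am aAW]]] := hull_env a.
have cK := card_hull W s Am; set K := [set x | _] in cK.
suff : (nsol phi a <= #|K|)%N \/ (#|UVpair p n s| <= nsol phi a + #|K|)%N.
  case=> H; [left; exact: leq_trans H cK|right; apply: (leq_trans H)].
  by rewrite leq_add2l.
apply: nsol_dichotomy => x y; rewrite !inE => xK yK.
have [h [h_iso h_id hxy]] := hull_transitive xK yK.
by case: (sat_conj h_iso phi (fun z => h_id _ _ (aAW z)) hxy).
Qed.

End SetAndSpace.

(** * Formulas with variables in the [U]-sort *)

Definition same_pattern m (T T' : eqType) (a : 'I_m -> T) (b : 'I_m ->
  T') : Prop :=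
  forall i j, (a i == a j) = (b i == b j).

Section EqualityPatterns.
Variables (T : finType) (m : nat).
Implicit Types a b : 'I_m -> T.

(** Induction on initial segments of the indices. A new value is corrected by the transposition of
    [s (a i0)] and [b i0]; equality of patterns keeps it from disturbing the earlier ones. *)
Lemma extend_to_perm a b : same_pattern a b ->
  exists s : {perm T}, forall i, s (a i) = b i.
Proof.
move=> ab; suff H k : (k <= m)%N ->
    exists s : {perm T}, forall i : 'I_m, (i < k)%N -> s (a i) = b i.
  by have [s Hs] := H m (leqnn m); exists s => i; apply: Hs.
elim: k => [_|k IH lt_k]; first by exists 1%g.
have [s Hs] := IH (ltnW lt_k); pose i0 := Ordinal lt_k.
have caseS (i : 'I_m) : (i < k.+1)%N -> (i < k)%N \/ i = i0.
  by rewrite ltnS leq_eqVlt => /orP[/eqP E|]; [right; apply: val_inj|left].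
have [/existsP[j /andP[lt_j /eqP E]]|/existsPn new] :=
  boolP [exists j : 'I_m, (j < k)%N && (a j == a i0)].
  exists s => i /caseS[/Hs//|->]; rewrite -E Hs //.
  by apply/eqP; rewrite -ab E.
exists (s * tperm (s (a i0)) (b i0))%g => i /caseS[lt_i|->];
  last by rewrite permM tpermL.
have := new i; rewrite lt_i /= => ai.
rewrite permM (Hs i lt_i) tpermD //; last by rewrite eq_sym -ab.
by rewrite -(Hs i lt_i) (inj_eq perm_inj) eq_sym.
Qed.

(** The chosen index depends only on the value [a i]. Equality patterns thus become maps from ['I_m]
    to itself, finitely many whatever [T] is. *)
Definition first_index a (i : 'I_m) : 'I_m :=
  odflt i [pick j | a j == a i].

Lemma first_index_eq a i j : (first_index a i == first_index a j) = (a i == a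
  j).
Proof.
have aE l : a (first_index a l) = a l.
  by rewrite /first_index; case: pickP => [k /eqP|].
apply/eqP/eqP => [E|E]; first by rewrite -aE E aE.
rewrite /first_index E; case: pickP => // /(_ j).
by rewrite eqxx.
Qed.

End EqualityPatterns.

(** Each quantifier passed may enlarge the hull by one generator, so this counts the spare
    dimensions that a formula requires. *)
Fixpoint qdepth (L : signature) (X : Type) (srt : X -> sorts L)
    (phi : formula srt) : nat :=
  match phi with
  | Imp phi psi => maxn (qdepth phi) (qdepth psi)
  | All s phi => (qdepth phi).+1
  | _ => 0
  end.

(** * Transfer of formulas along embeddings of large [M_n] *)

Section Transfer.
Variables (p : nat) (hp : prime p).

Lemma hull_extend (n : posnat) k (A : {set 'I_(p ^ val n)})
    (W : 'M['F_p]_(k, val n)) s (a : UVpair p n s) : (#|A| <= k)%N ->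
  exists (A' : {set 'I_(p ^ val n)}) (W' : 'M['F_p]_(k.+1, val n)),
    [/\ (#|A'| <= k.+1)%N, hull A' W' a
      & forall s (z : UVpair p n s), hull A W z -> hull A' W' z].
Proof.
move=> Ak.
have subW (v : 'rV['F_p]_(val n)) : (W <= col_mx v W)%MS.
  by rewrite -addsmxE addsmxSr.
have subv (v : 'rV['F_p]_(val n)) : (v <= col_mx v W)%MS.
  by rewrite -addsmxE addsmxSl.
case: s a => a.
  (* [W] is padded by a zero row so that one index [k.+1] bounds both parts. *)
  exists (a |: A), (col_mx (0 : 'rV_(val n)) W); split=> /=.
  - by rewrite cardsU1 -(add1n k) leq_add // leq_b1.
  - exact: setU11.
  case=> z /= zA; first by rewrite inE zA orbT.
  exact: submx_trans zA (subW _).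
exists A, (col_mx (a : 'rV_(val n)) W); split=> /=.
- exact: leqW.
- exact: subv.
case=> z //= zA.
exact: submx_trans zA (subW _).
Qed.

(** A hull on [k] generators has at most [p ^ k] elements in a sort with [p ^ n]. *)
Lemma exists_outside_hull (n : posnat) k (A : {set 'I_(p ^ val n)})
    (W : 'M['F_p]_(k, val n)) s : (#|A| <= k)%N -> (k < val n)%N ->
  exists a : UVpair p n s, ~~ hull A W a.
Proof.
move=> Ak kn; apply/existsP; rewrite -negb_forall; apply/negP => /forallP full.
have := card_hull hp W s Ak; rewrite (_ : [set x | _] = setT).
  by rewrite cardsT card_UV // leq_exp2l ?prime_gt1 // leqNgt kn.
by apply/setP => x; rewrite !inE; apply: full.
Qed.

Section Embedding.
Variables (n n' : posnat) (fU : 'I_(p ^ val n) -> 'I_(p ^ val n'))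
  (B : 'M['F_p]_(val n, val n')).
Hypotheses (fU_inj : injective fU)
  (B_inj : forall v : 'rV_(val n), v *m B = 0 -> v = 0).

Lemma hull_image k (A : {set 'I_(p ^ val n)}) (W : 'M['F_p]_(k, val n)) s
    (b : UVpair p n' s) :
  hull (fU @: A) (W *m B) b <-> exists2 a, hull A W a & UVmap fU B a = b.
Proof.
case: s b => b /=; split.
- by move/imsetP=> [a aA ->]; exists a.
- by move=> [a aA <-]; apply: imset_f.
- by case/submxP=> c ->; exists (c *m W); rewrite ?submxMl // mulmxA.
- by move=> [_ /submxP[c ->] <-]; rewrite -mulmxA submxMl.
Qed.

(* Tarski-Vaught: a witness outside the hull of the parameters is moved into
   the image of the embedding by an automorphism fixing the parameters. *)
Lemma sat_UVmap (X : Type) (srt : X -> bool) (phi : @formula (UV_sig p) X srt)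
    k (A : {set 'I_(p ^ val n)}) (W : 'M['F_p]_(k, val n))
    (e : env (UVpair p n) srt) :
  (#|A| <= k)%N -> (k + qdepth phi <= val n)%N -> (forall x, hull A W (e x)) ->
  sat phi e <-> sat (M := UVpair p n') phi (fun x => UVmap fU B (e x)).
Proof.
have hfun := UVmap_preserves fU B.
elim: phi k A W e => {X srt} [X srt s t u|X srt []|X srt|X srt phi IH1 psi IH2|
  X srt s phi IH] k A W e Ak //=.
- move=> _ _; rewrite !(teval_hom hfun).
  by split=> [->//|/(UVmap_inj fU_inj B_inj)].
- rewrite addn_maxr geq_max => /andP[k1 k2] eA.
  by rewrite (IH1 _ _ _ _ Ak k1 eA) (IH2 _ _ _ _ Ak k2 eA).
rewrite addnS -addSn => kn eA.
(* Adding [a] to the hull costs one generator, paid for by the quantifier just removed. *)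
have step a : sat phi (env_ext a e) <->
    sat phi (env_ext (UVmap fU B a) (fun x => UVmap fU B (e x))).
  have [A' [W' [A'k aA' AA']]] := hull_extend W a Ak.
  rewrite -(env_ext_hom (M := UVpair p n) (N := UVpair p n') (UVmap fU B)).
  by apply: (IH _ A' W') => // -[x|] //=; apply: AA'.
split=> [H b|H a]; last by apply/step/H.
have [/hull_image[a _ <-]|bA] := boolP (hull (fU @: A) (W *m B) b).
  by apply/step/H.
(* For [b] outside the target hull, any [a] outside the source hull has its image outside the target
   hull, and an automorphism over the parameters takes that image to [b]. *)
have kn' : (k < val n)%N by rewrite (leq_trans _ kn) // leq_addr.
have [a aA] := exists_outside_hull W s Ak kn'.
have aA' : ~~ hull (fU @: A) (W *m B) (UVmap fU B a).
  by apply: contra aA => /hull_image[a' a'A /(UVmap_inj fU_inj B_inj) <-].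
have [h [h_iso h_id hab]] := hull_transitive aA' bA.
have he x : h _ (UVmap fU B (e x)) = UVmap fU B (e x).
  by apply/h_id/hull_image; exists (e x).
by apply/(sat_conj h_iso phi he hab)/step/H.
Qed.

End Embedding.

(** For equal [n], a permutation of [U] is an automorphism, as nothing links the sorts. Otherwise
    [M_n] embeds into [M_n'] by the coordinate inclusion on [V] and, on [U], by an inclusion
    followed by a permutation carrying [a] to [b]. *)
Lemma sat_same_pattern m (rho : @formula (UV_sig p) 'I_m (fun=> Usort))
    (n n' : posnat) (a : 'I_m -> 'I_(p ^ val n)) (b : 'I_m -> 'I_(p ^ val n')) :
  n = n' \/ (m + qdepth rho <= val n <= val n')%N -> same_pattern a b ->
  sat (M := UVpair p n) rho a <-> sat (M := UVpair p n') rho b.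
Proof.
move=> [E|/andP[le_n le_n']] ab.
  case: _ / E b ab => b ab; have [s Hs] := extend_to_perm ab.
  have iso : struct_iso (M := UVpair p n) (N := UVpair p n) (UVmap s 1%:M).
    by apply: UVmap_iso => // [|v]; [exact: perm_inj|rewrite mulmx1].
  rewrite (sat_iso iso) /=.
  by have -> : b = (fun x => s (a x)) by apply: functional_extensionality_dep.
have le_p : (p ^ val n <= p ^ val n')%N by rewrite leq_exp2l // prime_gt1.
pose w (x : 'I_(p ^ val n)) := widen_ord le_p x.
have w_inj : injective w by move=> x y [/val_inj].
have [s Hs] : exists s : {perm 'I_(p ^ val n')}, forall i, s (w (a i)) = b i.
  by apply: extend_to_perm => i j; rewrite (inj_eq w_inj).
have [A [W [Am aAW]]] := hull_env (a : env (UVpair p n) (fun _ :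
  'I_m => Usort)).
have := @sat_UVmap n n' (fun x => s (w x)) (pid_mx (val n)) _ _ _ _ rho m A W a
  Am le_n aAW.
case=> [x y /perm_inj/w_inj //|v E|/= H1 H2].
  (* As [n <= n'], the inclusion matrix has a right inverse, which gives injectivity on [V]. *)
  suff pidK : (pid_mx (val n) : 'M['F_p]_(val n, val n')) *m
      (pid_mx (val n) : 'M_(val n', val n)) = 1%:M.
    by rewrite -[v]mulmx1 -pidK mulmxA E mul0mx.
  by rewrite mul_pid_mx minnn (minn_idPr le_n') pid_mx_1.
have -> : b = (fun x => s (w (a x))) by apply: functional_extensionality_dep.
by split.
Qed.

End Transfer.

(** * Expressing the trace in the pure set *)

Section Reflecting.
Variables (p : nat) (hp : prime p) (m : nat).

Definition UVar (i : 'I_m) : term (L :=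
  rsig set_lang) (fun _ : 'I_m => tt) tt :=
  Var (L := rsig set_lang) (srt := fun _ : 'I_m => tt) i.

Definition pattern_formula (c : 'I_m -> 'I_m) : rformula set_lang 'I_m :=
  fBigAnd (enum {: 'I_m * 'I_m}) (fun ij =>
    if c ij.1 == c ij.2 then Eq (UVar ij.1) (UVar ij.2)
    else fNot (Eq (UVar ij.1) (UVar ij.2))).

Lemma sat_pattern_formula (n : posnat) c (a : 'I_m -> 'I_(p ^ val n)) :
  sat (M := Uset p n) (pattern_formula c) a <-> same_pattern c a.
Proof.
rewrite sat_fBigAnd; split=> [H i j|H [i j] _ /=].
  have /= := H (i, j); rewrite mem_enum => /(_ isT).
  by case: (c i == c j) => /= E; [rewrite E eqxx|apply/esym/eqP].
have /= := H i j; case: (c i == c j) => /esym E /=; first exact/eqP.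
by apply/eqP; rewrite E.
Qed.

Definition size_atleast k : rformula set_lang 'I_m :=
  @atleast (rsig set_lang) k 'I_m (fun=> tt) tt (fTrue _).

Lemma sat_size_atleast (n : posnat) k (a : 'I_m -> 'I_(p ^ val n)) :
  sat (M := Uset p n) (size_atleast k) a <-> (k <= p ^ val n)%N.
Proof.
rewrite sat_atleast /nsol (_ : [set x | _] = setT) ?cardsT ?card_ord //.
by apply/setP => x; rewrite !inE; apply/asboolP.
Qed.

(* For [i = n0 - 1] this says "of size at least [p ^ n0]". *)
Definition size_formula (n0 : nat) (i : 'I_n0) : rformula set_lang 'I_m :=
  fAnd (size_atleast (p ^ i.+1))
    (if i.+1 == n0 then fTrue _ else fNot (size_atleast (p ^ i.+2))).

Lemma sat_size_formula (n : posnat) n0 (i : 'I_n0) (a : 'I_m ->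
  'I_(p ^ val n)) :
  sat (M := Uset p n) (size_formula i) a <->
  i.+1 = val n \/ (i.+1 = n0 /\ (n0 <= val n)%N).
Proof.
have le_exp k : (p ^ k <= p ^ val n)%N = (k <= val n)%N.
  by rewrite leq_exp2l // prime_gt1.
rewrite sat_fAnd sat_size_atleast le_exp; case: eqP => [E|/eqP E].
  rewrite E; split=> [[le _]|[->|[_ le]]]; first by right.
    by split=> // -[].
  by split=> // -[].
rewrite sat_fNot sat_size_atleast le_exp.
split=> [[le_i /negP]|[<-|[/eqP]]]; last by rewrite (negPf E).
  by rewrite -leqNgt => ge_i; left; apply/eqP; rewrite eqn_leq le_i.
by rewrite leqnn ltnn.
Qed.

End Reflecting.

(** For each value [i.+1] of [min(n, n0)], the formula lists the patterns realised in [M_(i.+1)] by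
    a tuple satisfying [rho]. *)
Lemma UV_selector_trace_reflecting p (hp : prime p) :
  selector_trace_reflecting p.
Proof.
(* From [m + qdepth rho] on, embeddings preserve [rho]; the successor makes [n0] positive, so
   [min(n, n0)] has the form [i.+1] with [i < n0]. *)
move=> m rho; pose n0 := (m + qdepth rho).+1.
pose pos (i : 'I_n0) : posnat := exist _ i.+1 (ltn0Sn i).
pose P (i : 'I_n0) (c : {ffun 'I_m -> 'I_m}) :=
  `[< exists a : 'I_m -> 'I_(p ^ i.+1),
  same_pattern c a /\ sat (M := UVpair p (pos i)) rho a >].
exists (fBigOr (enum 'I_n0) (fun i => fAnd (size_formula p m i)
  (fBigOr [seq c <- enum {ffun 'I_m -> 'I_m} | P i c]
     (fun c : {ffun 'I_m -> 'I_m} => pattern_formula c)))) => n a.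
have transfer (i : 'I_n0) (b : 'I_m -> 'I_(p ^ i.+1)) :
    i.+1 = val n \/ (i.+1 = n0 /\ (n0 <= val n)%N) -> same_pattern b a ->
    sat (M := UVpair p (pos i)) rho b <-> sat (M := UVpair p n) rho a.
  move=> Hi; apply: (@sat_same_pattern p hp m rho (pos i) n b a).
  case: Hi => [E|[E le]]; [left; exact: val_inj|right].
  by rewrite /= E le leqW.
split.
  case/sat_fBigOr => i _ /sat_fAnd[/(sat_size_formula hp) Hi].
  case/sat_fBigOr => c; rewrite mem_filter => /andP[/asboolP[b [cb Hb]] _].
  move=> /sat_pattern_formula ca.
  have ba : same_pattern b a by move=> j l; rewrite -ca cb.
  by case: (transfer i b Hi ba) => H _; apply: H.
move=> Ha; apply/sat_fBigOr.
have lt_i : ((minn (val n) n0).-1 < n0)%N by rewrite ltnS -subn1 leq_subLR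
  add1n geq_minr.
pose i := Ordinal lt_i.
have iE : i.+1 = minn (val n) n0.
  by rewrite /= prednK // leq_min (valP n).
have Hi : i.+1 = val n \/ (i.+1 = n0 /\ (n0 <= val n)%N).
  by rewrite iE; case: (leqP n0 (val n)) => [le|lt]; [right|left].
exists i; first by rewrite mem_enum.
apply/sat_fAnd; split; first exact/(sat_size_formula hp).
apply/sat_fBigOr; exists [ffun j => first_index a j]; last first.
  by apply/sat_pattern_formula => j l; rewrite !ffunE first_index_eq.
rewrite mem_filter mem_enum andbT; apply/asboolP.
(* The pattern of [a] is realised in [M_(i.+1)] by [a] itself if [i.+1 = n], and otherwise by the
   indices [first_index a j], as [m <= p ^ n0]. *)
have [b ba] : exists b : 'I_m -> 'I_(p ^ i.+1), same_pattern b a.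
  case: Hi => [->|[-> le]]; first by exists a.
  have le_m : (m <= p ^ n0)%N.
    by rewrite (leq_trans _ (ltnW (ltn_expl n0 (prime_gt1 hp)))) // leqW //
      leq_addr.
  exists (fun j => widen_ord le_m (first_index a j)) => j l.
  by rewrite -(first_index_eq a).
exists b; split; last by case: (transfer i b Hi ba) => _; apply.
by move=> j l; rewrite !ffunE first_index_eq ba.
Qed.

(** * Actions of a symmetric group with small supports *)

Section Supports.
Variables (T : finType) (V : zmodType) (to : V -> {perm T} -> V).
Hypotheses (to1 : forall v, to v 1%g = v)
  (toM : forall v (s t : {perm T}), to v (s * t)%g = to (to v s) t)
  (toD : forall u v s, to (u + v) s = to u s + to v s).

(** Transpositions of points outside [S] generate the pointwise stabiliser of [S], so this is the
    usual notion of support. *)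
Definition supports (S : {set T}) (v : V) : Prop :=
  forall x y, x \notin S -> y \notin S -> to v (tperm x y) = v.

Lemma supportsS (S S' : {set T}) v : S \subset S' -> supports S v ->
  supports S' v.
Proof.
move=> SS' Sv x y xS yS; apply: Sv; [apply: contra xS|apply: contra yS];
exact: (subsetP SS').
Qed.

Lemma supportsB S u v : supports S u -> supports S v -> supports S (u - v).
Proof.
move=> Su Sv x y xS yS; apply/eqP;
  rewrite eq_sym subr_eq -[X in _ + X](Sv x y) //.
by rewrite -toD subrK Su.
Qed.

(** The transposition of [x] outside [S] and [y] outside [S'] factors as [(x z)(z y)(x z)] with [z]
    outside both sets. *)
Lemma supportsI S S' v : (#|S :|: S'| < #|T|)%N ->
  supports S v -> supports S' v -> supports (S :&: S') v.
Proof.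
move=> lt_T Sv S'v.
have [z] : exists z, z \notin S :|: S'.
  apply/existsP; rewrite -negb_forall; apply/negP => /forallP full.
  by move: lt_T; rewrite (_ : S :|: S' = setT) ?cardsT ?ltnn //;
    apply/setP=> x; rewrite full inE.
rewrite inE negb_or => /andP[zS zS'].
have swap x y : x \notin S -> y \notin S' -> to v (tperm x y) = v.
  move=> xS yS'.
  have [->|xy] := eqVneq x y; first by rewrite tperm1 to1.
  have [zy|zy] := eqVneq z y; first by rewrite -zy Sv.
  have -> : tperm x y = (tperm x z * tperm z y * tperm x z)%g.
    have := tpermJ z y (tperm x z).
    by rewrite tpermR tpermD // conjgE tpermV mulgA => <-.
  by rewrite !toM (Sv x z) // (S'v z y) // (Sv x z).
move=> x y; rewrite !inE !negb_and => /orP[xS|xS'] /orP[yS|yS'].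
- exact: Sv.
- exact: swap.
- by rewrite tpermC; apply: swap.
- exact: S'v.
Qed.

Lemma supports_act S v (s : {perm T}) : supports S v ->
  supports (s @: S) (to v s).
Proof.
move=> Sv x y xS yS.
have xE : s ((s^-1)%g x) = x by rewrite permKV.
have yE : s ((s^-1)%g y) = y by rewrite permKV.
rewrite -toM; have -> : (s * tperm x y = tperm ((s^-1)%g x) ((s^-1)%g y) * s)%g.
  by rewrite -{1}xE -{1}yE -tpermJ conjgE !mulgA mulgV mul1g.
by rewrite toM Sv //; [apply: contra xS|apply: contra yS] => H;
  [rewrite -xE|rewrite -yE]; apply: imset_f.
Qed.

(** The complement of [S] is at least as large as [S], and an injection of [S] into it extends to a
    permutation. *)
Lemma disjoint_conjugate (S : {set T}) : (2 * #|S| <= #|T|)%N ->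
  exists s : {perm T}, [disjoint s @: S & S].
Proof.
move=> le_S.
have le_C : (#|S| <= #|~: S|)%N by rewrite -(leq_add2l #|S|
  ) cardsC addnn -mul2n.
pose a (i : 'I_#|S|) : T := enum_val i.
pose b (i : 'I_#|S|) : T := enum_val (widen_ord le_C i).
have [s Hs] : exists s : {perm T}, forall i, s (a i) = b i.
  by apply: extend_to_perm => i j; rewrite !(inj_eq enum_val_inj).
exists s; rewrite disjoint_subset; apply/subsetP => _ /imsetP[x xS ->].
rewrite -(enum_rankK_in xS xS) [s _]Hs inE.
by have := enum_valP (widen_ord le_C (enum_rank_in xS x)); rewrite inE.
Qed.

(* For [v] with a largest minimal support [S] and [s] moving [S] off itself,
   [v + s v] has a support of size at most [#|S|] which must contain [S], so it
   is [S]; hence [s v] is supported both by [S] and by [s S]. *)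
Lemma small_supports_trivial d : (3 * d < #|T|)%N ->
  (forall v, exists2 S : {set T}, (#|S| <= d)%N & supports S v) ->
  forall v s, to v s = v.
Proof.
move=> lt_T supp.
suff empty v : supports set0 v.
  (* Transpositions generate the symmetric group. *)
  move=> v s; have [ts -> _] := prod_tpermP s.
  elim: ts => [|t ts IH]; first by rewrite big_nil.
  by rewrite big_cons toM (empty v) ?inE.
pose bounded r := forall v, exists2 S : {set T}, (#|S| <= r)%N & supports S v.
(* Descent on the uniform bound for supports, from [d] to 0. *)
suff bounded0 r : (r <= d)%N -> bounded r -> bounded 0%N.
  have [S] := bounded0 d (leqnn d) supp v.
  by rewrite leqn0 cards_eq0 => /eqP ->.
elim: r => [//|r IH] le_r supp_r; apply: IH; first exact: ltnW.
move=> {}v; apply: contrapT => min_v.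
have minS (S : {set T}) : supports S v -> (r < #|S|)%N.
  by move=> Sv; rewrite ltnNge; apply/negP => le_S; apply: min_v; exists S.
have [S le_S Sv] := supp_r v.
have S_d : (#|S| <= d)%N by apply: leq_trans le_r.
have [s dis] : exists s : {perm T}, [disjoint s @: S & S].
  apply: disjoint_conjugate; rewrite (leq_trans _ (ltnW lt_T)) //.
  by rewrite leq_mul.
have S'v := supports_act (s := s) Sv.
have card_S' : #|s @: S| = #|S| by apply/card_imset/perm_inj.
have [Q le_Q Qw] := supp_r (v + to v s).
have Q_d : (#|Q| <= d)%N by apply: leq_trans le_r.
(* The hypothesis [3 * d < #|T|] leaves a point outside any three supports, as [supportsI]
   requires. *)
have card3 (X Y Z : {set T}) : (#|X| <= d)%N -> (#|Y| <= d)%N ->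
  (#|Z| <= d)%N ->
    (#|X :|: (Y :|: Z)| < #|T|)%N.
  move=> Xd Yd Zd; apply: leq_ltn_trans lt_T.
  rewrite (leq_trans (leq_card_setU _ _)) // 2!mulSn mul1n leq_add //.
  by rewrite (leq_trans (leq_card_setU _ _)) // leq_add.
have QS'v : supports (Q :|: s @: S) v.
  rewrite -[v](addrK (to v s)); apply: supportsB.
    exact: supportsS (subsetUl _ _) Qw.
  exact: supportsS (subsetUr _ _) S'v.
(* Both [S] and [Q :|: s @: S] support [v], so by minimality they meet in all of [S]; as [s @: S]
   misses [S], the set [Q] contains [S]. *)
have SQ : S \subset Q.
  have lt_S : (#|S| <= #|S :&: (Q :|: s @: S)|)%N.
    by apply/(leq_trans le_S)/minS/supportsI => //; apply: card3;
      rewrite ?card_S'.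
  have /setIidPl/subsetP SU : S :&: (Q :|: s @: S) = S.
    by apply/eqP; rewrite eqEcard subsetIl.
  apply/subsetP => x xS; have := SU x xS; rewrite inE => /orP[//|xS'].
  by have := disjointFr dis xS'; rewrite xS.
have {}SQ : S = Q.
  by apply/eqP; rewrite eqEcard SQ (leq_trans le_Q) // minS.
have SS'v : supports (S :&: s @: S) (to v s).
  apply: supportsI => //.
    by have := card3 S S (s @: S); rewrite setUA setUid card_S'; apply.
  rewrite -[to v s](addKr v) addrC; apply: supportsB => //.
  by rewrite {1}SQ.
(* Undoing [s] turns the empty support of [to v s] into one of [v], against minimality. *)
have : supports set0 v.
  rewrite -[v]to1 -(mulgV s) toM -(imset0 (s^-1)%g); apply: supports_act.
  by move: SS'v; rewrite setIC (disjoint_setI0 dis).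
by move/minS; rewrite cards0.
Qed.

End Supports.

(** * Interpretations *)

Lemma inj_surj_bij (X Y : Type) (f : X -> Y) :
  injective f -> (forall y, exists x, f x = y) -> bijective f.
Proof.
move=> f_inj /choice[g gK]; exists g => // x.
by apply: f_inj; rewrite gK.
Qed.

Section QuotientElements.
Variables (L1 L2 : rlang) (I : interp L1 L2) (M : rstruct L2).

Lemma mem_quot_nonempty (wf : well_defined I M) (C : quot I M) :
  exists t, t \in val C.
Proof.
have [rfl _ _ _] := wf; case: C => C /= /imsetP[t];
  rewrite inE => /asboolP tD ->.
by exists t; rewrite !inE; apply/andP; split; apply/asboolP; last exact: rfl.
Qed.

Lemma mem_quotP (wf : well_defined I M) (C : quot I M) t u : t \in val C ->
  reflect (tup_dom u /\ tup_equiv t u) (u \in val C).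
Proof.
have [_ sym trans _] := wf; move=> tC; apply: (iffP idP);
  case: C tC => C /= /imsetP[w].
  rewrite inE => /asboolP wD ->; rewrite !inE.
  move=> /andP[/asboolP tD /asboolP wt] /andP[/asboolP uD /asboolP wu].
  by split=> //; apply: trans wu => //; apply: sym.
rewrite inE => /asboolP wD ->; rewrite !inE.
move=> /andP[/asboolP tD /asboolP wt] [uD tu].
by apply/andP; split; apply/asboolP => //; apply: trans tu.
Qed.

Lemma mem_quot_dom (C : quot I M) t : t \in val C -> tup_dom t.
Proof. by case: C => C /= /imsetP[w _ ->]; rewrite !inE => /andP[/asboolP]. Qed.

Lemma quot_eq (wf : well_defined I M) (C C' : quot I M) t :
  t \in val C -> t \in val C' -> C = C'.
Proof.
move=> tC tC'; apply/val_inj/setP => u.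
by apply/(mem_quotP wf _ tC)/(mem_quotP wf _ tC').
Qed.

Lemma exists_quot (wf : well_defined I M) t : tup_dom t ->
  exists C : quot I M, t \in val C.
Proof.
move=> tD; have [rfl _ _ _] := wf.
have H : [set u in [set t : tup I M | `[< tup_dom t >]] | `[< tup_equiv t u >]]
    \in tup_classes I M by apply/imsetP; exists t; rewrite // inE;
      apply/asboolP.
by exists (exist (fun C => C \in tup_classes I M) _ H); rewrite !inE;
  apply/andP; split; apply/asboolP; last exact: rfl.
Qed.

End QuotientElements.

Section UsortInterpretation.
Variables (p : nat) (n : posnat).
Local Notation I := (Uinterp p).
Local Notation M := (UVcode p n).

Definition Utup (u : 'I_(p ^ val n)) : tup I M := [ffun=> Uelt u].

Lemma Uelt_inj : injective (@Uelt p n).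
Proof.
(* An option-valued projection reads off the [U]-part of a dependent pair, with [None] on
   vectors. *)
move=> u v /(congr1 (fun x : UVcode p n tt =>
  match x with existT s x =>
    match s return UV_carrier p (val n) s -> option 'I_(p ^ val n) with
    | true => fun u => Some u | false => fun=> None end x end)) /=.
by case.
Qed.

Lemma Uinterp_domP (t : tup I M) : tup_dom t <-> exists u, t = Utup u.
Proof.
split=> [|[u ->]]; last by rewrite /tup_dom /= ffunE.
rewrite /tup_dom /=; case E: (t ord0) => [s x] /= Es.
case: _ / (esym Es) x E => x E.
by exists x; apply/ffunP => i; rewrite (ord1 i) E ffunE.
Qed.

Lemma Uinterp_equivP (t u : tup I M) : tup_equiv t u <-> t = u.
Proof.
split=> [E|->//]; apply/ffunP => i; rewrite (ord1 i); exact: E.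
Qed.

Lemma Uinterp_well_defined : well_defined I M.
Proof.
split=> [t _|t u _ _|t u w _ _ _|[]]; rewrite ?Uinterp_equivP //.
by move=> -> ->.
Qed.

Lemma Uinterp_class u :
  exists C : quot I M, val C = [set Utup u].
Proof.
have [|C uC] := exists_quot (t := Utup u) Uinterp_well_defined.
  by apply/Uinterp_domP; exists u.
exists C; apply/setP => t; rewrite inE;
  apply/(mem_quotP Uinterp_well_defined _ uC)/eqP.
  by case=> _ /Uinterp_equivP.
by move=> ->; split; [apply/Uinterp_domP; exists u|apply/Uinterp_equivP].
Qed.

End UsortInterpretation.

Lemma Uinterp_is_correct p : Uinterp_correct p.
Proof.
move=> n; have wf := @Uinterp_well_defined p n.
have /choice[f fE] := @Uinterp_class p n.
have f_surj C : exists u, f u = C.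
  have [t tC] := mem_quot_nonempty wf C.
  have /Uinterp_domP[u tu] := mem_quot_dom tC.
  by exists u; apply: (quot_eq wf _ tC); rewrite fE tu inE.
split.
  exists f; split=> //; split=> //; split=> [|[]].
  apply: inj_surj_bij => // u v /(congr1 val); rewrite !fE => /set1_inj.
  by move=> /ffunP/(_ ord0); rewrite !ffunE => /Uelt_inj.
split=> // C; have [u <-] := f_surj C; exists (Utup u); split.
  by split; [rewrite fE inE|apply/Uinterp_domP; exists u].
by move=> t [+ _]; rewrite fE inE => /eqP.
Qed.

(** * The symmetric group acting on a structure interpreted in a pure set *)

Section PermutationAction.
Variables (L : rlang) (p : nat) (k : posnat) (J : interp L set_lang).
Local Notation A := (Uset p k).
Local Notation T := 'I_(p ^ val k).
Hypothesis wf : well_defined J A.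
Implicit Types (s : {perm T}) (C : quot J A).

Definition ptup s (t : tup J A) : tup J A := [ffun i => s (t i)].

Lemma sat_perm s (X : Type) (phi : rformula set_lang X) (e : X -> T) :
  sat (M := A) phi e <-> sat (M := A) phi (fun x => s (e x)).
Proof.
apply: (@sat_iso _ A A (fun=> s)).
by split=> [i|[]|[]]; exact: (Bijective (permK s) (permKV s)).
Qed.

Lemma ptup_dom s t : tup_dom t -> tup_dom (ptup s t).
Proof.
move=> /(sat_perm s); congr (sat _ _).
by apply: functional_extensionality_dep => i; rewrite ffunE.
Qed.

Lemma ptup_equiv s t u : tup_equiv t u -> tup_equiv (ptup s t) (ptup s u).
Proof.
move=> /(sat_perm s); congr (sat _ _).
by apply: functional_extensionality_dep => i; case: ifP; rewrite ffunE.
Qed.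

Lemma ptup_holds s (r : rel1 L) (v : 'I_(ar1 r) -> tup J A) :
  tup_holds v -> tup_holds (fun i => ptup s (v i)).
Proof.
move=> /(sat_perm s); congr (sat _ _).
by apply: functional_extensionality_dep => i; rewrite ffunE.
Qed.

(** Permutations preserve the domain and the equivalence. Class and permutation are paired so that
    one use of [choice] yields the action. *)
Lemma exists_quot_perm (Cs : quot J A * {perm T}) :
  exists C', forall t, t \in val Cs.1 -> ptup Cs.2 t \in val C'.
Proof.
case: Cs => C s /=; have [t tC] := mem_quot_nonempty wf C.
have [C' tC'] := exists_quot wf (ptup_dom s (mem_quot_dom tC)).
exists C' => u /(mem_quotP wf _ tC)[uD tu]; apply/(mem_quotP wf _ tC').
by split; [exact: ptup_dom|exact: ptup_equiv].
Qed.

Definition qact C s : quot J A := projT1 (choice exists_quot_perm) (C, s).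

Lemma mem_qact C s t : t \in val C -> ptup s t \in val (qact C s).
Proof. exact: (projT2 (choice exists_quot_perm) (C, s)). Qed.

Lemma qact_fix C s t : t \in val C -> ptup s t = t -> qact C s = C.
Proof.
by move=> tC st; apply: (quot_eq wf _ tC); rewrite -st mem_qact.
Qed.

Lemma qactM C s s' : qact C (s * s')%g = qact (qact C s) s'.
Proof.
have [t tC] := mem_quot_nonempty wf C.
apply: (quot_eq wf (mem_qact (s * s')%g tC)).
have -> : ptup (s * s')%g t = ptup s' (ptup s t).
  by apply/ffunP => i; rewrite !ffunE permM.
by do 2!apply: mem_qact.
Qed.

Lemma qact_rel s (r : rel1 L) (v : 'I_(ar1 r) -> quot J A) :
  quot_rel v -> quot_rel (fun i => qact (v i) s).
Proof.
case=> w wv w_holds; exists (fun i => ptup s (w i)); last exact: ptup_holds.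
by move=> i; apply: mem_qact.
Qed.

End PermutationAction.

(** * Bounding a vector space interpreted in a pure set *)

Section NoGroupInPureSet.
Variables (p : nat) (hp : prime p) (n k : posnat)
  (J : interp (code_lang (UV_sig p)) set_lang).
Local Notation A := (Uset p k).
Local Notation V := 'rV['F_p]_(val n).
Variable g : UVcode p n tt -> interp_struct J A tt.
Hypothesis g_interprets : interprets g.

Definition Velt (v : V) : UVcode p n tt :=
  @code_elt (UV_sig p) (UVpair p n) Vsort v.

(** Reads vectors back from equations between dependent pairs; the value 0 on [U] is a
    placeholder. *)
Definition Vpart (x : UVcode p n tt) : V :=
  match x with existT s x =>
    match s return UV_carrier p (val n) s -> V with
    | true => fun=> 0 | false => fun v => v end x end.

Lemma VeltK : cancel Velt Vpart.
Proof. by []. Qed.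

Definition sum_args (u v w : V) (i : 'I_3) : UVcode p n tt :=
  Velt (tnth [tuple u; v; w] i).

Lemma sum_graph (u v w : V) :
  @irel (rsig (code_lang (UV_sig p))) (UVcode p n)
    (@FunGraph (UV_sig p) (VAdd p)) (sum_args u v w) <-> w = u + v.
Proof.
split=> [[args [Hargs Hval]]|->].
  have u_arg := congr1 Vpart (Hargs ord0).
  have v_arg := congr1 Vpart (Hargs ord_max).
  have w_arg := congr1 Vpart Hval.
  have E : args ord0 + args ord_max = w by exact: esym w_arg.
  rewrite -E; congr (_ + _); [exact: esym u_arg|exact: esym v_arg].
exists (fun i : 'I_2 => tnth [tuple u; v] i); split=> //.
by move=> [[|[|//]] lt_i].
Qed.

Let wf : well_defined J A := proj1 g_interprets.

Lemma interprets_rel (r : rel1 (code_lang (UV_sig p)))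
    (v : 'I_(ar1 r) -> UVcode p n tt) :
  @irel (rsig (code_lang (UV_sig p))) (UVcode p n) r v <->
  quot_rel (fun i => g (v i) : quot J A).
Proof. exact: (proj2 (proj2 g_interprets)). Qed.

(** The [V]-sort is a predicate of the coded structure, so its interpreted copy is invariant under
    permutations of the pure set. *)
Lemma exists_vact (vs : V * {perm 'I_(p ^ val k)}) :
  exists v', g (Velt v') = qact wf (g (Velt vs.1)) vs.2.
Proof.
case: vs => v s /=; have [g' _ g'K] := proj1 (proj2 g_interprets).
have := @interprets_rel (@SortPred (UV_sig p) Vsort) (fun=> Velt v).
case=> /(_ erefl) /(qact_rel wf s) /= + _.
rewrite -[qact _ _ _]g'K; set x := g' _ => H.
have : tag x = Vsort by apply/(@interprets_rel (@SortPred (UV_sig p) Vsort)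
  (fun=> x)).
case: (x) => b y /= E; case: _ / (esym E) y => y.
by exists y.
Qed.

Definition vact (v : V) (s : {perm 'I_(p ^ val k)}) : V :=
  projT1 (choice exists_vact) (v, s).

Lemma g_vact v s : g (Velt (vact v s)) = qact wf (g (Velt v)) s.
Proof. exact: (projT2 (choice exists_vact) (v, s)). Qed.

Lemma gV_inj : injective (fun v => g (Velt v)).
Proof.
exact: inj_comp (bij_inj (proj1 (proj2 g_interprets))) (can_inj VeltK).
Qed.

(** This makes the coordinates of any representative of [v] a support of [v]. *)
Lemma vact_fix v s t : t \in val (g (Velt v) : quot J A) -> ptup s t = t ->
  vact v s = v.
Proof. by move=> tv st; apply: gV_inj; rewrite /= g_vact (qact_fix wf tv). Qed.

Lemma vact1 v : vact v 1%g = v.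
Proof.
have [t tv] := mem_quot_nonempty wf (g (Velt v)).
by apply: (vact_fix tv); apply/ffunP => i; rewrite ffunE perm1.
Qed.

Lemma vactM v (s s' : {perm 'I_(p ^ val k)}) :
  vact v (s * s')%g = vact (vact v s) s'.
Proof. by apply: gV_inj; rewrite /= !g_vact qactM. Qed.

(** The graph of addition is a relation of the coded structure, and the action preserves interpreted
    relations. *)
Lemma vactD u v s : vact (u + v) s = vact u s + vact v s.
Proof.
apply/sum_graph; apply/(@interprets_rel (@FunGraph (UV_sig p) (VAdd p))).
have /(@interprets_rel (@FunGraph (UV_sig p) (VAdd p)))/(qact_rel wf s) :=
  (sum_graph u v (u + v)).2 erefl.
congr quot_rel; apply: functional_extensionality_dep.
by move=> [[|[|[|//]]] lt_i]; rewrite -g_vact.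
Qed.

(** Supports have at most [idim J] points, so the action on [V] is trivial. Vectors whose
    representatives share an equality pattern are conjugate, hence equal, and the patterns are coded
    by self-maps of ['I_(idim J)]. *)
Lemma interprets_card_le : (3 * idim J < p ^ val k)%N ->
  (p ^ val n <= idim J ^ idim J)%N.
Proof.
move=> lt_k.
have vact_triv v s : vact v s = v.
  apply: (small_supports_trivial vact1 vactM vactD (d := idim J)).
    by rewrite card_ord.
  move=> {}v; have [t tv] := mem_quot_nonempty wf (g (Velt v)).
  exists [set t i | i : 'I_(idim J)].
    by rewrite -[leqRHS]card_ord leq_imset_card.
  move=> x y xt yt; apply: (vact_fix tv); apply/ffunP => i; rewrite ffunE.
  have ti : t i \in [set t i | i : 'I_(idim J)] by apply: imset_f.
  by rewrite tpermD //; apply: contraTneq ti => <-.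
have /choice[t tv] : forall v, exists t, t \in val (g (Velt v) : quot J A).
  by move=> v; apply: mem_quot_nonempty.
pose pat v : {ffun 'I_(idim J) -> 'I_(idim J)} :=
  [ffun i => first_index (t v) i].
have pat_inj : injective pat.
  move=> u v /ffunP uv.
  have [s Hs] : exists s : {perm 'I_(p ^ val k)}, forall i, s (t u i) = t v i.
    apply: extend_to_perm => i j.
    have := uv i; have := uv j; rewrite !ffunE => Ej Ei.
    by rewrite -(first_index_eq (t u)) -(first_index_eq (t v)) Ei Ej.
  have Es : ptup s (t u) = t v by apply/ffunP => i; rewrite ffunE.
  apply: gV_inj => /=; apply: (quot_eq wf _ (tv v)).
  by rewrite -Es -(vact_triv u s) g_vact vact_triv mem_qact.
have := leq_card pat pat_inj.
by rewrite card_ffun card_ord card_mx card_Fp // mul1n.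
Qed.

End NoGroupInPureSet.

(** Pigeonhole: [b.+2] indices above [a] cannot all have images at most [b]. *)
Lemma injective_unbounded (alpha : posnat -> posnat) (a b : nat) :
  injective alpha -> exists k, (a < val k)%N && (b < val (alpha k))%N.
Proof.
move=> alpha_inj.
pose pos (i : 'I_b.+2) : posnat := exist _ (a + i).+1 (ltn0Sn _).
have pos_inj : injective pos by move=> i j [/addnI/val_inj].
have [/existsP[i lt_i]|/existsPn small] :=
  boolP [exists i, (b < val (alpha (pos i)))%N].
  by exists (pos i); rewrite lt_i /= ltnS leq_addr.
have le_b i : (val (alpha (pos i)) < b.+1)%N by rewrite ltnS leqNgt.
have ord_inj : injective (fun i => Ordinal (le_b i)).
  by move=> i j /(congr1 val) E; apply/pos_inj/alpha_inj/val_inj.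
by have := leq_card _ ord_inj; rewrite !card_ord ltnn.
Qed.

(** Uniformity fixes the dimension [d] of [J] for all [k]. Choosing [k > 3 * d] with
    [alpha k > d ^ d] gives more vectors than [interprets_card_le] allows. *)
Lemma U_not_biinterpretable p (hp : prime p) :
  ~ unif_weakly_biinterpretable (Uset p) (UVcode p).
Proof.
move=> [alpha [I [J [chi [alpha_inj H]]]]].
pose d := idim J.
have [k /andP[lt_k lt_n]] := injective_unbounded (3 * d) (d ^ d) alpha_inj.
have [f [g [gI [_ g_int _ _]]]] := H k.
have lt_exp m : (m < p ^ m)%N by rewrite ltn_expl // prime_gt1.
have := interprets_card_le hp g_int (ltn_trans lt_k (lt_exp _)).
by rewrite leqNgt (ltn_trans lt_n).
Qed.

Theorem theorem10p7 (R : realType) (p : nat) (hp : prime p) :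
  one_dim_asymptotic_class R (Uset p) /\
  one_dim_asymptotic_class R (UVpair p) /\
  Uinterp_correct p /\
  selector_trace_reflecting p /\
  ~ unif_weakly_biinterpretable (Uset p) (UVcode p).
Proof.
split; first exact: Uset_one_dim.
split; first exact: UVpair_one_dim.
split; first exact: Uinterp_is_correct.
split; first exact: UV_selector_trace_reflecting.
exact: U_not_biinterpretable.
Qed.
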